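(* Let $n,m\in\mathbb N_0$ and $g=(g_1,\dots,g_m)\in\mathbb R[X]^m$ such that $M(g)$ is Archimedean. Moreover, let $k\in\mathbb N_0$, $N\in\mathbb N$ and $\varepsilon\in\mathbb R_{>0}$. Then there exists $d\in\mathbb N_0$ such that for all $f\in\mathbb R[X]_N$ with all coefficients in $[-N,N]$ and all $x_1,\dots,x_k\in\mathbb R^n$ with $$\{x\in S(g)\mid f(x)=0\}=\{x_1,\dots,x_k\}$$ the following holds: if the balls $B_\varepsilon(x_1),\dots,B_\varepsilon(x_k)$ are pairwise disjoint and contained in $S(g)$, and if $f\ge\varepsilon u$ on $S(g)$ where $u:=u_{x_1}\cdots u_{x_k}\in\mathbb R[X]$, then $f\in M_d(g)$.
   Context: $\mathbb N$ and $\mathbb N_0$ are the positive and the nonnegative integers. $\mathbb R[X]=\mathbb R[X_1,\dots,X_n]$, and $\mathbb R[X]_N$ is the space of polynomials of (total) degree at most $N$. For $g=(g_1,\dots,g_m)\in\mathbb R[X]^m$ set $g_0:=1$ and $S(g):=\{x\in\mathbb R^n\mid g_1(x)\ge0,\dots,g_m(x)\ge0\}$. For $d\in\mathbb N_0$ the $d$-truncated quadratic module is $$M_d(g):=\Big\{\sum_{i=0}^m\sum_j p_{ij}^2g_i\ \Big|\ p_{ij}\in\mathbb R[X],\ \deg(p_{ij}^2g_i)\le d\Big\}$$ (the inner sums are finite of arbitrary length; $\deg 0:=-\infty$), and $M(g):=\bigcup_{d\in\mathbb N_0}M_d(g)$ is the quadratic module generated by $g$. $M(g)$ is called Archimedean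 if for every $p\in\mathbb R[X]$ there is $N'\in\mathbb N$ with $N'+p\in M(g)$ and $N'-p\in M(g)$. $B_\varepsilon(x):=\{y\in\mathbb R^n\mid\|x-y\|<\varepsilon\}$ is the open Euclidean ball. For $x\in\mathbb R^n$, $u_x:=(X_1-x_1)^2+\dots+(X_n-x_n)^2\in\mathbb R[X]$ (here $x_1,\dots,x_n$ denote the coordinates of $x$). The empty product is $1$. ''$f\ge h$ on $S$'' means $f(x)\ge h(x)$ for all $x\in S$. *)

(* Defs.v *)
From mathcomp Require Import all_boot all_order all_algebra.
(* mpoly must be imported before any file of MathComp-Analysis proper: the other
   order is rejected because of clashing notation levels. *)
From mathcomp Require Import mpoly.
From mathcomp Require Import boolp classical_sets reals.

Set Implicit Arguments.
Unset Strict Implicit.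
Unset Printing Implicit Defensive.

Import Order.TTheory GRing.Theory Num.Theory.
Local Open Scope ring_scope.
Local Open Scope classical_set_scope.

Section Definitions.
Context {R : realType} {n : nat}.
Implicit Types (f p : {mpoly R[n]}) (x y : 'rV[R]_n).

(* [msize p] is [deg p + 1] for [p != 0] and [msize 0 = 0], so that this is
   [deg p <= d] with the convention [deg 0 = -oo]. *)
Definition deg_le (d : nat) p : Prop := (msize p <= d.+1)%N.

Definition peval f x : R := f.@[x ord0].

Definition enorm x : R := Num.sqrt (\sum_(i < n) x ord0 i ^+ 2).

(* The library's [ball] on row vectors is the one of the sup norm. *)
Definition eball x (e : R) : set 'rV[R]_n := [set y | enorm (x - y) < e].

Definition upoly x : {mpoly R[n]} := \sum_(i < n) ('X_i - (x ord0 i)%:MP) ^+ 2.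

Section QuadraticModule.
Context {m : nat}.
Implicit Type g : 'I_m -> {mpoly R[n]}.

Definition semialg g : set 'rV[R]_n := [set x | forall i, 0 <= peval (g i) x].

(* The family [g_0 = 1, g_1, ..., g_m]; [g i] sits at index [lift ord0 i]. *)
Definition with_one g (i : 'I_m.+1) : {mpoly R[n]} :=
  if unlift ord0 i is Some j then g j else 1.

Definition trunc_qmodule (d : nat) g : set {mpoly R[n]} :=
  [set f | exists s : 'I_m.+1 -> seq {mpoly R[n]},
     (forall i p, p \in s i -> deg_le d (p ^+ 2 * with_one g i)) /\
     f = \sum_(i < m.+1) \sum_(p <- s i) p ^+ 2 * with_one g i].

Definition qmodule g : set {mpoly R[n]} := \bigcup_d trunc_qmodule d g.

Definition archimedean g : Prop :=
  forall p, exists N' : nat,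
    [/\ (0 < N')%N, qmodule g (N'%:R + p) & qmodule g (N'%:R - p)].

End QuadraticModule.
End Definitions.

(* Main.v *)
Require Import Defs.
From HB Require Import structures.
From mathcomp Require Import all_boot all_order all_algebra.
From mathcomp Require Import mpoly.
From mathcomp Require Import boolp classical_sets functions reals.
From mathcomp Require Import ring lra.

Import Order.TTheory GRing.Theory Num.Theory.
Local Open Scope ring_scope.
Local Open Scope classical_set_scope.

(** Why the theorem holds.

    Uniformity is built in from the start.  Over an index set of parameters, the
    families of polynomials with uniformly bounded degrees and coefficients form
    the ring [{mpoly B[n]}], where [B] is the ring of bounded families of reals,
    and the families whose members all lie in one and the same [M_d(g)] form a
    quadratic module [uniform_qmodule] in it.  This module is again Archimedean,
    and a common degree for all the members of a family is membership in it.
    So it suffices to prove, in this ring, a Positivstellensatz for one element.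
    A ring homomorphism from this ring to the reals plays the role of a limit
    along the parameters.

    The Positivstellensatz for an element [f] with zeros goes as follows.  Let
    [u] be the product of the squared distances [u_i] to the zeros.

    - [f] is bounded by [u]: for each [p] some [c * u + p * f] is in the module
      ([f_bounded_by_U]).  For one zero this is Taylor expansion, as [f] vanishes
      to order two; several zeros are combined through comaximality, zeros being
      at distance at least [e] ([bounded_by_mul]).
    - Given that bound, a multiplier [s] with [s * f - u] in the module suffices
      for [f] to be in the module ([denominator_free], an order-unit argument
      in which [u] replaces [1]).
    - The elements [p] such that [p * u + s * f] is in the module for some
      multiplier [s] form a quadratic module [Q], and such an [s] exists as soon
      as [-1] is in [Q].  Otherwise Zorn's lemma yields a character
      nonnegative on [Q] ([exists_character]).  So it is enough to exhibit, for
      each character, an element of [Q] on which it is negative ([local_global]).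
    - If the character does not vanish on [u], then it is positive on [f], by
      the bound [f >= e u], and [- u * f] is such an element.
    - If it vanishes on [u_i], then the local shape of [f] at the corresponding
      zero is used.  The Hessian of [f] is bounded below there, so that the leading
      form minus a small multiple of [u_i] is a sum of squares, and the cubic
      remainder is absorbed by a large multiple of [u_i ^+ 2].  Hence
      [f - r * u_i + c * u_i ^+ 2] is in the module ([local_certificate]), and
      multiplying by the square of the product of the other [u_j] gives the
      required element. *)

Set Implicit Arguments.
Unset Strict Implicit.
Unset Printing Implicit Defensive.

(** * Archimedean quadratic modules and their characters *)

Record quadratic_module (A : comNzRingType) (M : set A) : Prop :=
  QuadraticModule {
    qm1 : M 1;
    qmD : forall a b, M a -> M b -> M (a + b);
    qmX : forall a b, M b -> M (a ^+ 2 * b) }.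

(** Sums of squares are multipliers; working with multipliers instead avoids
    carrying lists of squares. *)
Definition multiplier (A : comNzRingType) (M : set A) (s : A) : Prop :=
  forall a, M a -> M (s * a).

Section AbstractQuadraticModules.
Variables (R : realType) (A : comNzRingType) (iota : {rmorphism R -> A}).
Implicit Types (M Q : set A) (a b p s u v y z : A) (c d r : R).

Definition order_unit M : Prop := forall a, exists c, M (iota c - a).

Section Basics.
Variable M : set A.
Hypothesis qM : quadratic_module M.

Lemma qm_sqr a : M (a ^+ 2).
Proof. by rewrite -[_ ^+ 2]mulr1; apply: (qmX qM _ (qm1 qM)). Qed.

Lemma qm0 : M 0.
Proof. by have := qm_sqr 0; rewrite expr0n. Qed.

Lemma qmZ c a : 0 <= c -> M a -> M (iota c * a).
Proof. by move=> c0 Ma; rewrite -(sqr_sqrtr c0) rmorphXn; apply: qmX. Qed.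

Lemma qmC c : 0 <= c -> M (iota c).
Proof. by move=> c0; rewrite -[iota c]mulr1; apply: (qmZ c0); apply: qm1. Qed.

Lemma qmZ_inv c a : 0 < c -> M (iota c * a) -> M a.
Proof.
move=> c0 Mca; have : M (iota c^-1 * (iota c * a)).
  by apply: qmZ Mca; rewrite invr_ge0 ltW.
by rewrite mulrA -rmorphM mulVf ?gt_eqF// rmorph1 mul1r.
Qed.

Lemma qm_sum (I : Type) (l : seq I) (P : pred I) (F : I -> A) :
  (forall i, P i -> M (F i)) -> M (\sum_(i <- l | P i) F i).
Proof.
by move=> MF; apply: big_ind => //; [exact: qm0|move=> a b; apply: qmD].
Qed.

Lemma multiplierD s t : multiplier M s -> multiplier M t -> multiplier M (s + t).
Proof. by move=> ms mt a Ma; rewrite mulrDl; apply: qmD; [|apply: ms|apply: mt]. Qed.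

Lemma multiplierM s t : multiplier M s -> multiplier M t -> multiplier M (s * t).
Proof. by move=> ms mt a Ma; rewrite -mulrA; apply/ms/mt. Qed.

Lemma multiplier_sqr s : multiplier M (s ^+ 2).
Proof. by move=> a; apply: qmX. Qed.

Lemma multiplier0 : multiplier M 0.
Proof. by move=> a _; rewrite mul0r; apply: qm0. Qed.

Lemma multiplier1 : multiplier M 1.
Proof. by move=> a; rewrite mul1r. Qed.

Lemma multiplier_in s : multiplier M s -> M s.
Proof. by move=> ms; rewrite -[s]mulr1; apply: ms (qm1 qM). Qed.

Lemma multiplier_sum (I : Type) (l : seq I) (P : pred I) (F : I -> A) :
  (forall i, P i -> multiplier M (F i)) -> multiplier M (\sum_(i <- l | P i) F i).
Proof.
move=> MF; apply: big_ind => //; first exact: multiplier0.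
by move=> a b; apply: multiplierD.
Qed.

Lemma multiplier_prod (I : Type) (l : seq I) (P : pred I) (F : I -> A) :
  (forall i, P i -> multiplier M (F i)) -> multiplier M (\prod_(i <- l | P i) F i).
Proof.
move=> MF; apply: big_ind => //; first exact: multiplier1.
by move=> a b; apply: multiplierM.
Qed.

Lemma order_unit_ge0 (oM : order_unit M) a : exists2 c, 0 < c & M (iota c - a).
Proof.
have [c Mc] := oM a; exists (Num.max c 0 + 1).
  by rewrite ltr_wpDl // le_max lexx orbT.
have -> : iota (Num.max c 0 + 1) - a = iota (Num.max c 0 + 1 - c) + (iota c - a).
  by ring.
apply: qmD => //; apply: qmC.
by rewrite subr_ge0 (le_trans (_ : c <= Num.max c 0)) ?le_max ?lexx // lerDl.
Qed.

(** [4 a = (a + 1) ^+ 2 - (a - 1) ^+ 2] turns stability under squares into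
    stability under arbitrary factors. *)
Lemma support_ideal s a : M s -> M (- s) -> M (s * a).
Proof.
move=> Ms MNs; apply: (@qmZ_inv 4); first by lra.
have -> : iota 4 * (s * a) = (a + 1) ^+ 2 * s + (a - 1) ^+ 2 * - s by ring.
by apply: qmD => //; apply: qmX.
Qed.

End Basics.

Section Characters.

(** Zorn's lemma is applied to the sets [X] for which [M `|` X] is a proper
    quadratic module, so that the empty chain has an upper bound as well. *)
Lemma maximal_quadratic_module M :
  quadratic_module M -> ~ M (-1) ->
  exists Q, [/\ quadratic_module Q, M `<=` Q, ~ Q (-1) &
    forall Q', quadratic_module Q' -> Q `<=` Q' -> ~ Q' (-1) -> Q' `<=` Q].
Proof.
move=> qM M1.
pose P := [set X : set A | quadratic_module (M `|` X) /\ ~ (M `|` X) (-1)].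
have [F FP Ftot|E [[qE E1] Emax]] := @Zorn_bigcup A P.
- split; last by case=> // -[X FX Xm1]; have [_] := FP X FX; apply; right.
  split; first by left; apply: qm1.
  + have lift X a b : F X -> (M `|` X) a -> (M `|` X) b ->
        (M `|` \bigcup_(X in F) X) (a + b).
      move=> FX Xa Xb; have [qX _] := FP X FX.
      by have [|] := qmD qX Xa Xb; [left|right; exists X].
    move=> a b [Ma|[X FX Xa]] [Mb|[Y FY Yb]].
    * by left; apply: qmD.
    * by apply: (lift Y) => //; [left|right].
    * by apply: (lift X) => //; [right|left].
    * have [XY|YX] := Ftot X Y FX FY.
        by apply: (lift Y) => //; right => //; apply: XY.
      by apply: (lift X) => //; right => //; apply: YX.
  + move=> a b [Mb|[X FX Xb]]; first by left; apply: qmX.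
    have [qX _] := FP X FX.
    by have [|] := qmX qX a (or_intror Xb); [left|right; exists X].
- exists (M `|` E); split => //
 Q' qQ' EQ' Q'1 a Q'a; apply: contrapT => Ea.
  have MQ' : M `|` Q' = Q' by apply/setUidPr => b Mb; apply: EQ'; left.
  apply: (Emax Q'); last by split; rewrite MQ'.
  split; first by move=> b Eb; apply: EQ'; right.
  by move=> /(_ a Q'a) E_a; apply: Ea; right.
Qed.

Section Maximal.
Variable Q : set A.
Hypotheses (qQ : quadratic_module Q) (Q1 : ~ Q (-1)) (oQ : order_unit Q).
Hypothesis maxQ : forall Q', quadratic_module Q' -> Q `<=` Q' -> ~ Q' (-1) ->
  Q' `<=` Q.

Lemma adjoin_in a :
  ~ Q a -> exists q s, [/\ Q q, multiplier Q s & -1 = q + s * a].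
Proof.
move=> Qa; pose Q' := [set b | exists q s, [/\ Q q, multiplier Q s & b = q + s * a]].
apply: contrapT => Q'1; apply: Qa; apply: (maxQ (Q' := Q')) => //.
- split.
  + by exists 1, 0; split; [apply: qm1|apply: multiplier0|ring].
  + move=> _ _ [q [s [Qq ms ->]]] [q' [s' [Qq' ms' ->]]].
    by exists (q + q'), (s + s'); split; [apply: qmD|apply: multiplierD|ring].
  + move=> b _ [q [s [Qq ms ->]]]; exists (b ^+ 2 * q), (b ^+ 2 * s).
    split; [exact: qmX|apply: multiplierM => //|by ring].
    exact: multiplier_sqr.
- by move=> b Qb; exists b, 0; split; [|apply: multiplier0|ring].
- by exists 0, 1; split; [apply: qm0|apply: multiplier1|ring].
Qed.

(** If neither [a] nor [- a] were in [Q], both could be adjoined at the price of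
    [-1]; eliminating [a] between the two relations puts the multiplier [s1] of [a]
    in the support of [Q], which is an ideal, so that [-1] is already in [Q]. *)
Lemma maximal_total a : Q a \/ Q (- a).
Proof.
apply: contrapT => /not_orP [Qa QNa].
have [q1 [s1 [Qq1 ms1 e1]]] := adjoin_in Qa.
have [q2 [s2 [Qq2 ms2 e2]]] := adjoin_in QNa.
have Qs1 : Q s1 by apply: multiplier_in.
have QNs1 : Q (- s1).
  have -> : - s1 = s2 + (s1 * q2 + s2 * q1).
    have h1 : q1 = - 1 - s1 * a by rewrite e1; ring.
    have h2 : q2 = - 1 + s2 * a by rewrite e2; ring.
    by rewrite h1 h2; ring.
  by do 2?[apply: qmD => //]; [apply: multiplier_in|apply: ms1|apply: ms2].
by apply: Q1; rewrite e1; apply: qmD => //; apply: support_ideal.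
Qed.

Lemma no_negative_constant r : Q (iota r) -> 0 <= r.
Proof.
move=> Qr; rewrite leNgt; apply/negP => r0; apply: Q1.
apply: (@qmZ_inv _ qQ (- r)); first by rewrite oppr_gt0.
by rewrite mulrN1 rmorphN opprK.
Qed.

Definition infinitesimal a := forall r, 0 < r -> Q (iota r + a) /\ Q (iota r - a).

(** The value of the character at [a] is the supremum of the reals below [a]. *)
Lemma standard_part a : exists c, infinitesimal (a - iota c).
Proof.
pose E := [set r | Q (a - iota r)].
have hE : has_sup E.
  have [c Qc] := oQ a; have [d Qd] := oQ (- a).
  split.
    by exists (- d); rewrite /E/= rmorphN opprK addrC -[a]opprK.
  exists c => r Er; rewrite -subr_ge0; apply: no_negative_constant.
  by have := qmD qQ Er Qc; congr Q; ring.
exists (sup E) => r r0; split.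
  have [x Ex xr] := sup_adherent r0 hE.
  have : Q (iota (x - sup E + r)) by apply: qmC => //; lra.
  by move=> /(qmD qQ Ex); congr Q; ring.
have [Qa|] := maximal_total (a - iota (sup E + r)).
  have /(sup_upper_bound hE) : E (sup E + r) by [].
  by rewrite gerDl leNgt r0.
by congr Q; ring.
Qed.

Lemma infinitesimalN a : infinitesimal a -> infinitesimal (- a).
Proof. by move=> ia r /ia [H1 H2]; rewrite opprK. Qed.

Lemma infinitesimalD a b : infinitesimal a -> infinitesimal b -> infinitesimal (a + b).
Proof.
move=> ia ib r r0; have r2 : 0 < r / 2 by lra.
have er : iota r = iota (r / 2) + iota (r / 2) by rewrite -rmorphD; congr (iota _); lra.
have [a1 a2] := ia _ r2; have [b1 b2] := ib _ r2; rewrite er; split.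
  by have := qmD qQ a1 b1; congr Q; ring.
by have := qmD qQ a2 b2; congr Q; ring.
Qed.

Lemma infinitesimal_const r : infinitesimal (iota r) -> r = 0.
Proof.
move=> ir; apply/eqP; rewrite eq_le; apply/andP; split; apply/ler_addgt0Pl => e e0.
  have [_] := ir e e0; rewrite -rmorphB => /no_negative_constant; lra.
have [+ _] := ir e e0; rewrite -rmorphD => /no_negative_constant; lra.
Qed.

(** [2 a b] is between [- (a ^+ 2 / h + h * b ^+ 2)] and [a ^+ 2 / h + h * b ^+ 2],
    where [h] makes the second term small, [b] being bounded, and [a ^+ 2] is
    infinitesimal compared with [h]. *)
Lemma infinitesimalMr a b : infinitesimal a -> infinitesimal (a * b).
Proof.
move=> ia.
have half r : 0 < r -> Q (iota r - a ^+ 2).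
  move=> r0; pose d := Num.min 1 r; have d0 : 0 < d by rewrite lt_min ltr01.
  have [c1 c2] := ia d d0.
  have H : Q (iota (2 * d) * (iota (d ^+ 2) - a ^+ 2)).
    have := qmD qQ (qmX qQ (iota d + a) c2) (qmX qQ (iota d - a) c1).
    by congr Q; ring.
  have {}H := qmZ_inv qQ (_ : 0 < 2 * d) H.
  have dr : d ^+ 2 <= r.
    have [h1 h2] : d <= 1 /\ d <= r by rewrite !ge_min !lexx orbT.
    by rewrite expr2; nra.
  have : Q (iota (r - d ^+ 2)) by apply: qmC => //; rewrite subr_ge0.
  by move=> /(qmD qQ (H ltac:(lra))); congr Q; ring.
have [K K0 QK] := order_unit_ge0 qQ oQ (b ^+ 2).
move=> r r0.
have e0 : 0 < r / K by rewrite divr_gt0.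
have key (sgn : R) : sgn ^+ 2 = 1 -> Q (iota r - iota sgn * (a * b)).
  move=> sg.
  have h1 := qm_sqr qQ (a - iota (sgn * (r / K)) * b).
  have h2 := qmZ qQ (_ : 0 <= (r / K) ^+ 2) QK.
  have h3 := half (r ^+ 2 / K) (divr_gt0 (exprn_gt0 _ r0) K0).
  have := qmD qQ (qmD qQ h1 (h2 (sqr_ge0 _))) h3.
  move=> H; apply: (@qmZ_inv _ qQ (2 * (r / K))); first by lra.
  move: H; congr Q.
  have -> : iota (sgn * (r / K)) = iota sgn * iota (r / K) by rewrite rmorphM.
  have hs : iota sgn ^+ 2 = 1 by rewrite -rmorphXn sg rmorph1.
  have -> : (a - iota sgn * iota (r / K) * b) ^+ 2 =
     a ^+ 2 - 2 * iota sgn * iota (r / K) * a * b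
     + iota sgn ^+ 2 * iota (r / K) ^+ 2 * b ^+ 2 by ring.
  rewrite hs.
  have -> : iota (2 * (r / K)) * (iota r - iota sgn * (a * b)) =
    iota (2 * (r / K) * r) - 2 * iota (r / K) * iota sgn * a * b by ring.
  have -> : 2 * (r / K) * r = (r / K) ^+ 2 * K + r ^+ 2 / K by field; rewrite gt_eqF.
  by rewrite rmorphXn; ring.
split.
  by have := key (-1) ltac:(by rewrite sqrrN expr1n); congr Q; ring.
by have := key 1 ltac:(by rewrite expr1n); congr Q; ring.
Qed.

Lemma maximal_character :
  exists phi : {rmorphism A -> R},
    (forall a, Q a -> 0 <= phi a) /\ (forall c, phi (iota c) = c).
Proof.
have /choice [f fP] := standard_part.
have uniq a c : infinitesimal (a - iota c) -> f a = c.
  move=> ic; apply/eqP; rewrite -subr_eq0; apply/eqP; apply: infinitesimal_const.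
  have := infinitesimalD ic (infinitesimalN (fP a)).
  by congr infinitesimal; ring.
have inf0 : infinitesimal 0.
  by move=> r r0; rewrite addr0 subr0; split; apply: qmC => //; apply: ltW.
have fC c : f (iota c) = c by apply: uniq; rewrite subrr.
have fB : zmod_morphism f.
  move=> a b; apply: uniq.
  have := infinitesimalD (fP a) (infinitesimalN (fP b)); congr infinitesimal; ring.
have fM : monoid_morphism f.
  split; first by rewrite -(rmorph1 iota).
  move=> a b; apply: uniq.
  have := infinitesimalD (infinitesimalMr b (fP a)) (infinitesimalMr (iota (f a)) (fP b)).
  by congr infinitesimal; ring.
pose phiA := GRing.isZmodMorphism.Build A R f fB.
pose phiM := GRing.isMonoidMorphism.Build A R f fM.
pose phi : {rmorphism A -> R} := HB.pack f phiA phiM.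
exists phi; split => // a Qa; rewrite leNgt; apply/negP => fa0.
have fa0' : f a < 0 by [].
have [] := fP a (- f a / 2) ltac:(lra) => _ /(qmD qQ Qa) Q'.
have : Q (iota (f a / 2)).
  move: Q'; congr Q.
  have -> : f a / 2 = - f a / 2 + f a by lra.
  by rewrite rmorphD; ring.
by move=> /no_negative_constant; lra.
Qed.

End Maximal.

Lemma exists_character Q :
  quadratic_module Q -> order_unit Q -> ~ Q (-1) ->
  exists phi : {rmorphism A -> R},
    (forall a, Q a -> 0 <= phi a) /\ (forall c, phi (iota c) = c).
Proof.
move=> qQ oQ Q1; have [Q' [qQ' QQ' Q'1 Q'max]] := maximal_quadratic_module qQ Q1.
have oQ' : order_unit Q' by move=> a; have [c Qc] := oQ a; exists c; apply: QQ'.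
have [phi [phiQ phiC]] := maximal_character qQ' Q'1 oQ' Q'max.
by exists phi; split=> // a Qa; apply/phiQ/QQ'.
Qed.

End Characters.
End AbstractQuadraticModules.

(** * A local-global principle with a denominator *)

Section LocalGlobal.
Variables (R : realType) (A : comNzRingType) (iota : {rmorphism R -> A}).
Implicit Types (a b f p s u v y z : A) (c d r : R).
Variable M : set A.
Hypotheses (qM : quadratic_module M) (oM : order_unit iota M).

(** These [f] form an ideal; the [M]-analogue of [f = O(u)]. *)
Definition bounded_by u f : Prop := forall p, exists c, M (iota c * u + p * f).

(** The [M]-analogue of [y = O(sqrt u)]. *)
Definition dominated u y : Prop := exists c, M (iota c * u - y ^+ 2).

Lemma bounded_by_ge0 u f p : multiplier M u -> bounded_by u f ->
  exists2 c, 0 < c & M (iota c * u + p * f).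
Proof.
move=> mu /(_ p) [c Mc]; exists (`|c| + 1); first by rewrite ltr_wpDl.
have Mu : M (iota (`|c| + 1 - c) * u).
  apply: qmZ => //; last exact: multiplier_in.
  by have := ler_norm c; lra.
by have := qmD qM Mu Mc; congr M; ring.
Qed.

Lemma dominated_ge0 u y : multiplier M u -> dominated u y ->
  exists2 c, 0 < c & M (iota c * u - y ^+ 2).
Proof.
move=> mu [c Mc]; exists (`|c| + 1); first by rewrite ltr_wpDl.
have Mu : M (iota (`|c| + 1 - c) * u).
  apply: qmZ => //; last exact: multiplier_in.
  by have := ler_norm c; lra.
by have := qmD qM Mu Mc; congr M; ring.
Qed.

Lemma bounded_byD u f g : bounded_by u f -> bounded_by u g -> bounded_by u (f + g).
Proof.
move=> bf bg p; have [c Mc] := bf p; have [d Md] := bg p.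
by exists (c + d); have := qmD qM Mc Md; congr M; ring.
Qed.

Lemma bounded_byM u f p : bounded_by u f -> bounded_by u (p * f).
Proof. by move=> bf q; have [c Mc] := bf (q * p); exists c; rewrite mulrA. Qed.

Lemma bounded_by1 f : bounded_by 1 f.
Proof.
by move=> p; have [c Mc] := oM (- (p * f)); exists c; rewrite mulr1 -[p * f]opprK.
Qed.

Lemma bounded_by_sum (I : Type) (l : seq I) (P : pred I) u (F : I -> A) :
  (forall i, P i -> bounded_by u (F i)) -> bounded_by u (\sum_(i <- l | P i) F i).
Proof.
move=> bF; apply: big_ind => //; last by move=> a b; apply: bounded_byD.
by move=> p; exists 0; rewrite rmorph0 mul0r mulr0 addr0; apply: qm0.
Qed.

Section Domination.
Variable u : A.
Hypothesis mu : multiplier M u.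

Lemma dominatedD y z : dominated u y -> dominated u z -> dominated u (y + z).
Proof.
move=> [c Mc] [d Md]; exists (2 * c + 2 * d).
have := qmD qM (qm_sqr qM (y - z)) (qmZ iota qM (_ : 0 <= 2) (qmD qM Mc Md)).
by move=> /(_ ltac:(lra)); congr M; ring.
Qed.

Lemma dominatedM p y : dominated u y -> dominated u (p * y).
Proof.
move=> /(dominated_ge0 mu) [c c0 Mc]; have [d Md] := oM (p ^+ 2).
exists (d * c).
have := qmD qM (qmX qM p Mc) (qmZ iota qM (ltW c0) (mu Md)).
by congr M; ring.
Qed.

Lemma dominated_sum (I : Type) (l : seq I) (P : pred I) (F : I -> A) :
  (forall i, P i -> dominated u (F i)) -> dominated u (\sum_(i <- l | P i) F i).
Proof.
move=> bF; apply: big_ind => //; last by move=> a b; apply: dominatedD.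
by exists 0; rewrite rmorph0 mul0r expr0n subr0; apply: qm0.
Qed.

Lemma dominated_bounded y z :
  dominated u y -> dominated u z -> bounded_by u (y * z).
Proof.
move=> dy dz p; have [c Mc] := dominatedM p dy; have [d Md] := dz.
exists ((c + d) / 2); apply: (@qmZ_inv _ _ iota _ qM 2); first by lra.
have := qmD qM (qm_sqr qM (p * y + z)) (qmD qM Mc Md); congr M.
have -> : iota 2 * (iota ((c + d) / 2) * u + p * (y * z)) =
  iota (2 * ((c + d) / 2)) * u + 2 * p * y * z by ring.
by rewrite (_ : 2 * _ = c + d); [ring|lra].
Qed.

Lemma dominated_zero (phi : {rmorphism A -> R}) y :
  (forall a, M a -> 0 <= phi a) -> phi u = 0 -> dominated u y -> phi y = 0.
Proof.
move=> phi0 u0 [c /phi0]; rewrite rmorphB rmorphXn rmorphM u0 mulr0 sub0r oppr_ge0.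
by move=> y2; apply/eqP; rewrite -sqrf_eq0 eq_le y2 sqr_ge0.
Qed.

End Domination.

Lemma dominated_mul u v y z : multiplier M u -> multiplier M v ->
  dominated u y -> dominated v z -> dominated (u * v) (y * z).
Proof.
move=> mu mv /(dominated_ge0 mu) [c c0 Mc] /(dominated_ge0 mv) [d d0 Md].
exists (c * d).
have := qmD qM (qmZ iota qM (ltW c0) (mu _ Md)) (qmX qM z Mc).
by congr M; ring.
Qed.

Lemma bounded_by_sqr u v f y : multiplier M u -> multiplier M v ->
  bounded_by u f -> dominated v y -> bounded_by (u * v) (y ^+ 2 * f).
Proof.
move=> mu mv bf /(dominated_ge0 mv) [d d0 Md] p.
have [c c0 Mc] := bounded_by_ge0 p mu bf; exists (c * d).
have := qmD qM (qmX qM y Mc) (qmZ iota qM (ltW c0) (mu _ Md)).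
by congr M; ring.
Qed.

(** The cofactors come from [1 = (y + z) ^+ 3], each monomial of which is
    divisible by [y ^+ 2] or by [z ^+ 2]. *)
Lemma bounded_by_mul u v f y z : multiplier M u -> multiplier M v ->
  dominated u y -> dominated v z -> y + z = 1 ->
  bounded_by u f -> bounded_by v f -> bounded_by (u * v) f.
Proof.
move=> mu mv dy dz yz bu bv.
have -> : f = (y + 3 * z) * (y ^+ 2 * f) + (3 * y + z) * (z ^+ 2 * f).
  by rewrite -[LHS]mul1r -(expr1n _ 3) -[in LHS]yz; ring.
apply: bounded_byD; apply: bounded_byM; last exact: bounded_by_sqr.
by rewrite mulrC; apply: bounded_by_sqr.
Qed.

Lemma prod_comaximal (I : Type) (l : seq I) (P : pred I) (U : I -> A) v :
  multiplier M v -> (forall i, P i -> multiplier M (U i)) ->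
  (forall i, P i -> exists y z, [/\ dominated (U i) y, dominated v z & y + z = 1]) ->
  exists y z, [/\ dominated (\prod_(i <- l | P i) U i) y, dominated v z & y + z = 1].
Proof.
move=> mv mU cU.
pose K u := multiplier M u /\
  exists y z, [/\ dominated u y, dominated v z & y + z = 1].
suff [] : K (\prod_(i <- l | P i) U i) by [].
apply: big_ind.
- split; first exact: multiplier1.
  exists 1, 0; split; last by rewrite addr0.
  + by exists 1; rewrite rmorph1 expr1n mul1r subrr; apply: qm0.
  + by exists 0; rewrite rmorph0 mul0r expr0n subr0; apply: qm0.
- move=> a b [ma [y [z [ay vz yz]]]] [mb [y' [z' [by' vz' yz']]]].
  split; first exact: multiplierM.
  exists (y * y'), (z * (y' + z') + y * z'); split; first exact: dominated_mul.
    by apply: dominatedD; [rewrite mulrC|]; apply: dominatedM.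
  by rewrite addrCA -mulrDr yz' !mulr1 addrC.
- by move=> i Pi; split; [apply: mU|apply: cU].
Qed.

Lemma bounded_by_prod (I : eqType) (l : seq I) (U : I -> A) f :
  uniq l ->
  (forall i, multiplier M (U i)) ->
  (forall i j, i != j ->
     exists y z, [/\ dominated (U i) y, dominated (U j) z & y + z = 1]) ->
  (forall i, bounded_by (U i) f) -> bounded_by (\prod_(i <- l) U i) f.
Proof.
move=> + mU cU bU; elim: l => [|j l IH] /=; first by rewrite big_nil => _; apply: bounded_by1.
move=> /andP [jl ul]; rewrite big_cons mulrC.
have [|y [z [dy dz yz]]] := @prod_comaximal _ l (fun i => i \in l) U (U j) (mU j) (fun i _ => mU i).
  by move=> i il; apply: cU; apply: contraNneq jl => <-.
rewrite -big_seq in dy.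
apply: bounded_by_mul dy dz yz _ _ => //; first exact: multiplier_prod.
exact: IH.
Qed.

(** Starting from [r * u + f] in [M], the constant [r] can be lowered by [k^-1]
    for a fixed [k], thanks to the identity
    [k^2 (f + (r - 1/k) u) = (k - s)^2 (f + r u) + 2 k (s f - u)
      + r u s (2 k - s) + (k u - s^2 f)],
    all of whose terms are in [M] for [k] large. *)
Lemma denominator_free u f s : multiplier M u -> bounded_by u f ->
  multiplier M s -> M (s * f - u) -> M f.
Proof.
move=> mu bf ms Msf.
have Mu : M u by apply: multiplier_in.
have [r0 r0gt Mr0] := bounded_by_ge0 1 mu bf; rewrite mul1r in Mr0.
have [k1 k1gt Mk1] := order_unit_ge0 qM oM s.
have [k2 k2gt Mk2] := bounded_by_ge0 (- s ^+ 2) mu bf.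
pose k := k1 + k2.
have kgt : 0 < k by rewrite addr_gt0.
have Mks : M (iota (2 * k) - s).
  have := qmD qM (qmC iota qM (_ : 0 <= 2 * k2 + k1)) Mk1.
  by move=> /(_ ltac:(lra)); congr M; rewrite /k; ring.
have Mkf : M (iota k * u - s ^+ 2 * f).
  by have := qmD qM (qmZ iota qM (ltW k1gt) Mu) Mk2; congr M; rewrite /k; ring.
have Mss : M (s * (iota (2 * k) - s)).
  apply: (@qmZ_inv _ _ iota _ qM (2 * k)); first by lra.
  have := qmD qM (ms _ (qm_sqr qM (iota (2 * k) - s))) (qmX qM s Mks).
  by congr M; ring.
have step r : 0 <= r -> M (iota r * u + f) -> M (iota (r - k^-1) * u + f).
  move=> rge Mr; apply: (@qmZ_inv _ _ iota _ qM (k ^+ 2)); first exact: exprn_gt0.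
  have h1 := qmX qM (iota k - s) Mr.
  have h2 := qmZ iota qM (_ : 0 <= 2 * k) Msf.
  have h3 := qmZ iota qM rge (mu _ Mss).
  have := qmD qM (qmD qM h1 (h2 ltac:(lra))) (qmD qM h3 Mkf).
  congr M.
  have -> : iota (k ^+ 2) * (iota (r - k^-1) * u + f) =
    iota (k ^+ 2 * (r - k^-1)) * u + iota (k ^+ 2) * f by ring.
  rewrite (_ : k ^+ 2 * _ = k ^+ 2 * r - k); first by ring.
  by field; rewrite gt_eqF.
(* The maximum keeps the constant nonnegative, as [step] requires. *)
have descent j : M (iota (Num.max 0 (r0 - j%:R * k^-1)) * u + f).
  elim: j => [|j IH]; first by rewrite mul0r subr0 max_r // ltW.
  set r := Num.max 0 _ in IH.
  have rge : 0 <= r by rewrite le_max lexx.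
  have Mr := step r rge IH.
  set r' := Num.max 0 _.
  have rr' : r - k^-1 <= r'.
    rewrite /r /r' -natr1 mulrDl mul1r opprD addrA.
    have : 0 < k^-1 by rewrite invr_gt0.
    case: (leP 0 (r0 - _)) => h k0; rewrite le_max; first by rewrite lexx orbT.
    by apply/orP; left; lra.
  have := qmD qM Mr (qmZ iota qM (_ : 0 <= r' - (r - k^-1)) Mu).
  by move=> /(_ ltac:(lra)); congr M; ring.
have : M (iota (Num.max 0 (r0 - (Num.bound (r0 * k))%:R * k^-1)) * u + f) by [].
rewrite max_l ?rmorph0 ?mul0r ?add0r // subr_le0 -ler_pdivrMr ?invr_gt0 // invrK.
by apply/ltW/archi_boundP; rewrite mulr_ge0 // ltW.
Qed.

(** The argument is applied to the quadratic module [Q] of those [p] for which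
    [p * u] is in [M] modulo multiples of [f] by multipliers: [-1] in [Q] is exactly
    what [denominator_free] needs, and a character of [Q] contradicts the hypothesis. *)
Lemma local_global u f : multiplier M u -> bounded_by u f ->
  (forall phi : {rmorphism A -> R},
     (forall a, M a -> 0 <= phi a) -> (forall c, phi (iota c) = c) ->
     exists s p, [/\ multiplier M s, M (p * u + s * f) & phi p < 0]) ->
  M f.
Proof.
move=> mu bf loc.
pose Q := [set p | exists2 s, multiplier M s & M (p * u + s * f)].
have MQ : M `<=` Q.
  move=> a Ma; exists 0; first exact: multiplier0.
  by rewrite mul0r addr0 mulrC; apply: mu.
have qQ : quadratic_module Q.
  split; first exact: MQ (qm1 qM).
  - move=> a b [s ms Ms] [t mt Mt]; exists (s + t); first exact: multiplierD.
    by have := qmD qM Ms Mt; congr M; ring.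
  - move=> a b [s ms Ms]; exists (a ^+ 2 * s).
      by apply: multiplierM => //; apply: multiplier_sqr.
    by have := qmX qM a Ms; congr M; ring.
have oQ : order_unit iota Q by move=> a; have [c Mc] := oM a; exists c; apply: MQ.
have [[s ms]|Q1] := pselect (Q (-1)).
  rewrite mulN1r addrC; exact: denominator_free.
have [phi [phiQ phiC]] := exists_character qQ oQ Q1.
have [s [p [ms Mp]]] := loc phi (fun a Ma => phiQ a (MQ a Ma)) phiC.
by rewrite ltNge phiQ //; exists s.
Qed.

End LocalGlobal.

(** * Taylor expansion and second-order minima *)

Section Polynomials.
Variables (B : comNzRingType) (n : nat).
Implicit Types (p q : {mpoly B[n]}) (x : 'I_n -> B).

Lemma mpoly_ring_ind (P : {mpoly B[n]} -> Prop) :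
  (forall c, P c%:MP) -> (forall i, P 'X_i) ->
  (forall p q, P p -> P q -> P (p + q)) ->
  (forall p q, P p -> P q -> P (p * q)) -> forall p, P p.
Proof.
move=> PC PX PD PM; elim/mpolyind => [|c m p _ _ Pp]; first by rewrite -mpolyC0.
apply: (PD) => //; rewrite -mul_mpolyC; apply: (PM) => //; rewrite mpolyXE_id.
apply: big_ind; [by rewrite -mpolyC1|by move=> p' q'; apply: (PM)|].
by move=> i _; elim: (m i) => [|k IH]; rewrite ?expr0 -?mpolyC1 ?exprS //; apply: (PM).
Qed.

(** The decompositions of [p - p(x)] are stable under ring operations, so that
    constants and variables suffice. *)
Lemma mpoly_translate x p : exists r : 'I_n -> {mpoly B[n]},
  p = (p.@[x])%:MP + \sum_j r j * ('X_j - (x j)%:MP).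
Proof.
elim/mpoly_ring_ind: p => [c|i|p q [r hp] [r' hq]|p q [r hp] [r' hq]].
- exists (fun=> 0); rewrite mevalC big1 ?addr0 // => i _; exact: mul0r.
- exists (fun j => (j == i)%:R); rewrite mevalXU (bigD1 i) //= eqxx mul1r.
  rewrite big1 ?addr0; first by ring.
  by move=> j /negPf ->; rewrite mul0r.
- exists (fun j => r j + r' j); rewrite mevalD mpolyCD {1}hp {1}hq.
  under [X in _ = _ + X]eq_bigr do rewrite mulrDl.
  by rewrite big_split /=; ring.
- exists (fun j => r j * q + (p.@[x])%:MP * r' j); rewrite mevalM mpolyCM.
  under [X in _ = _ + X]eq_bigr do rewrite mulrDl mulrAC -(mulrA _ (r' _)).
  rewrite big_split /= -mulr_suml -mulr_sumr.
  set S := \sum_j r j * _ in hp *; set S' := \sum_j r' j * _ in hq *.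
  have hS : S = p - (p.@[x])%:MP by apply/eqP; rewrite eq_sym subr_eq addrC; apply/eqP.
  have hS' : S' = q - (q.@[x])%:MP by apply/eqP; rewrite eq_sym subr_eq addrC; apply/eqP.
  by rewrite hS hS'; ring.
Qed.

Lemma mpoly_taylor2 x p (Z := fun j => 'X_j - (x j)%:MP) :
  exists (d : 'I_n -> B) (a : 'I_n -> 'I_n -> B)
         (b : 'I_n -> 'I_n -> 'I_n -> {mpoly B[n]}),
  p = (p.@[x])%:MP + \sum_j (d j)%:MP * Z j
      + \sum_j \sum_l (a j l)%:MP * (Z j * Z l)
      + \sum_j (\sum_l \sum_m b j l m * (Z l * Z m)) * Z j.
Proof.
have [r {1}->] := mpoly_translate x p.
have /choice [r' r'E] := fun j => mpoly_translate x (r j).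
have /choice [b bE] := fun jl : 'I_n * 'I_n => mpoly_translate x (r' jl.1 jl.2).
exists (fun j => (r j).@[x]), (fun j l => (r' j l).@[x]), (fun j l => b (j, l)).
rewrite {}/Z -!addrA; congr (_ + _); rewrite -!big_split /=; apply: eq_bigr => j _.
rewrite {1}(r'E j) mulrDl; congr (_ + _).
rewrite !mulr_suml -big_split /=; apply: eq_bigr => l _.
rewrite {1}(bE (j, l)) /= mulrDl mulrDl; congr (_ + _); first by ring.
by rewrite !mulr_suml; apply: eq_bigr => m _; ring.
Qed.

End Polynomials.

Section RealPolynomials.
Variables (R : realType) (n : nat).
Implicit Types (p q : {mpoly R[n]}) (x v y : 'I_n -> R).

Lemma mpoly_line_bounded p x v :
  exists C, forall s, `|s| <= 1 -> `|p.@[fun i => x i + s * v i]| <= C.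
Proof.
elim/mpoly_ring_ind: p => [c|i|p q [C hp] [C' hq]|p q [C hp] [C' hq]].
- by exists `|c| => s _; rewrite mevalC.
- exists (`|x i| + `|v i|) => s s1; rewrite mevalXU (le_trans (ler_normD _ _)) //.
  by rewrite lerD2l normrM ler_piMl.
- exists (C + C') => s s1; rewrite mevalD (le_trans (ler_normD _ _)) //.
  by rewrite lerD ?hp ?hq.
- exists (C * C') => s s1; rewrite mevalM normrM.
  by rewrite ler_pM ?hp ?hq.
Qed.

Lemma second_order_sign (a b C e : R) (r : R -> R) :
  0 < e -> (forall s, `|s| <= 1 -> `|r s| <= C) ->
  (forall s, `|s| <= 1 -> `|s| <= e -> 0 <= s * a + s ^+ 2 * b + s ^+ 3 * r s) ->
  a = 0 /\ 0 <= b.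
Proof.
move=> e0 rC h.
have C0 : 0 <= C by rewrite (le_trans _ (rC 0 _)) ?normr0.
pose K := `|b| + C + 1; have K0 : 0 < K by rewrite /K; have := normr_ge0 b; lra.
have small t : 0 < t -> exists s, [/\ 0 < s, s <= 1, s <= e & s * K <= t].
  move=> t0; exists (Num.min e (Num.min 1 (t / K))).
  have tK : 0 < t / K by rewrite divr_gt0.
  split; rewrite -?ler_pdivlMr // ?lt_min ?e0 ?tK ?ltr01 // !ge_min lexx ?orbT //.
have a0 : a = 0.
  apply/eqP; rewrite -normr_le0; apply/ler_addgt0Pl => t t0; rewrite addr0.
  have [s [s0 s1 se sK]] := small t t0.
  (* The sign of [s'] makes the linear term equal to [- s * `|a|]. *)
  pose s' := - Num.sg a * s.
  have [->|an0] := eqVneq a 0; first by rewrite normr0 ltW.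
  have ns' : `|s'| = s by rewrite normrM normrN normr_sg an0 mul1r gtr0_norm.
  have := h s'; rewrite ns' => /(_ s1 se).
  have : `|r s'| <= C by apply: rC; rewrite ns'.
  have es2 : s' ^+ 2 = s ^+ 2 by rewrite -[LHS](real_normK (num_real _)) ns'.
  rewrite (exprS s' 2) es2 (_ : s' * a = - (s * `|a|)); last first.
    by rewrite /s' normrEsg; ring.
  move=> rs'; rewrite (_ : _ * r s' = s ^+ 2 * (s' * r s')); last by ring.
  have : s' * r s' <= C.
    rewrite (le_trans (ler_norm _)) // normrM ns' (le_trans _ rs') //.
    by rewrite ler_piMl.
  have := ler_norm b; have := normr_ge0 b.
  rewrite /K in sK; move=> hb1 hb2 hr hh.
  have : s * `|a| <= s * (s * (`|b| + C)) by nra.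
  rewrite ler_pM2l // => /le_trans; apply; nra.
split => //; rewrite leNgt; apply/negP => b0.
have [s [s0 s1 se sK]] := small (- b / 2) ltac:(lra).
have ns : `|s| = s by rewrite gtr0_norm.
have := h s; rewrite ns a0 mulr0 add0r => /(_ s1 se).
have rs : r s <= C by rewrite (le_trans (ler_norm _)) // rC // ns.
have -> : s ^+ 2 * b + s ^+ 3 * r s = s ^+ 2 * (b + s * r s) by ring.
rewrite pmulr_rge0 ?exprn_gt0 // /K in sK *.
have : s * r s <= s * C by rewrite ler_pM2l.
have : 0 <= s * `|b| by rewrite mulr_ge0 // ltW.
by nra.
Qed.

(** Restricting [p] to a line through [x] gives a function
    [s * D + s ^+ 2 * Q + O(s ^+ 3)] that is at least [c * s ^+ 2 * |v| ^+ 2] for small [s]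
    of both signs. *)
Lemma second_order_minimum x p (d : 'I_n -> R) (a : 'I_n -> 'I_n -> R)
    (b : 'I_n -> 'I_n -> 'I_n -> {mpoly R[n]}) (c e : R)
    (Z := fun j => 'X_j - (x j)%:MP) :
  p = \sum_j (d j)%:MP * Z j + \sum_j \sum_l (a j l)%:MP * (Z j * Z l)
      + \sum_j (\sum_l \sum_m b j l m * (Z l * Z m)) * Z j ->
  0 < e ->
  (forall y, \sum_i (y i - x i) ^+ 2 <= e ->
             c * \sum_i (y i - x i) ^+ 2 <= p.@[y]) ->
  (forall j, d j = 0) /\
  (forall v, c * \sum_i v i ^+ 2 <= \sum_j \sum_l a j l * (v j * v l)).
Proof.
move=> pE e0 pge.
suff H v : \sum_j d j * v j = 0 /\
    0 <= \sum_j \sum_l a j l * (v j * v l) - c * \sum_i v i ^+ 2.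
  split=> [j|v]; last by rewrite -subr_ge0; apply: (H v).2.
  have [+ _] := H (fun i => (i == j)%:R); rewrite (bigD1 j) //= eqxx mulr1.
  by rewrite big1 ?addr0 // => i /negPf ->; rewrite mulr0.
pose r s := \sum_j \sum_l \sum_m (b j l m).@[fun i => x i + s * v i] * (v l * v m * v j).
have [C rC] : exists C, forall s, `|s| <= 1 -> `|r s| <= C.
  pose q := \sum_j \sum_l \sum_m b j l m * (v l * v m * v j)%:MP.
  have [C qC] := mpoly_line_bounded q x v; exists C => s /qC.
  rewrite /q /r raddf_sum; under eq_bigr do rewrite raddf_sum.
  under eq_bigr do under eq_bigr do rewrite raddf_sum.
  under eq_bigr do under eq_bigr do under eq_bigr do rewrite /= mevalM mevalC.
  by [].
set V := \sum_i v i ^+ 2.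
have V0 : 0 <= V by apply: sumr_ge0 => i _; apply: sqr_ge0.
pose e' := Num.min 1 (e / (V + 1)).
have V1 : 0 < V + 1 by lra.
have e'0 : 0 < e' by rewrite lt_min ltr01 divr_gt0.
apply: (second_order_sign e'0 rC) => s s1 se.
have ss : s ^+ 2 <= e / (V + 1).
  have : `|s| <= e / (V + 1) by rewrite (le_trans se) // ge_min lexx orbT.
  rewrite -(real_normK (num_real s)); have := normr_ge0 s; rewrite expr2; nra.
have dist : \sum_i (x i + s * v i - x i) ^+ 2 = s ^+ 2 * V.
  by rewrite /V mulr_sumr; apply: eq_bigr => i _; ring.
have := pge (fun i => x i + s * v i); rewrite dist => /(_ _).
have sV : s ^+ 2 * V <= e.
  rewrite (le_trans (_ : _ <= e / (V + 1) * V)) ?ler_wpM2r //.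
  by rewrite mulrAC ler_pdivrMr //; nra.
move=> /(_ sV); rewrite -subr_ge0; congr (0 <= _).
have ZE j : (Z j).@[fun i => x i + s * v i] = s * v j.
  by rewrite /Z mevalB mevalXU mevalC; ring.
have -> : p.@[fun i => x i + s * v i] = s * (\sum_j d j * v j)
    + s ^+ 2 * (\sum_j \sum_l a j l * (v j * v l)) + s ^+ 3 * r s; last by ring.
rewrite {}pE !mevalD !raddf_sum /=; congr (_ + _ + _); rewrite mulr_sumr.
- by apply: eq_bigr => j _; rewrite mevalM mevalC ZE; ring.
- apply: eq_bigr => j _; rewrite raddf_sum mulr_sumr; apply: eq_bigr => l _.
  by rewrite /= !mevalM mevalC !ZE; ring.
- apply: eq_bigr => j _; rewrite mevalM raddf_sum ZE mulr_sumr mulr_suml.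
  apply: eq_bigr => l _; rewrite raddf_sum mulr_sumr mulr_suml.
  by apply: eq_bigr => m _; rewrite /= !mevalM !ZE; ring.
Qed.

End RealPolynomials.

(** * Positive definite quadratic forms *)

Section PositiveDefiniteForms.
Variable R : realType.

(** [b] symmetrizes the first row and column: the matrix [a] need not be
    symmetric. *)
Lemma complete_square (S : comNzRingType) (iota : {rmorphism R -> S}) n
    (a : 'I_n.+1 -> 'I_n.+1 -> R) (y : 'I_n.+1 -> S)
    (b := fun j => (a ord0 (lift ord0 j) + a (lift ord0 j) ord0) / 2) :
  a ord0 ord0 != 0 ->
  \sum_j \sum_l iota (a j l) * (y j * y l) =
    iota (a ord0 ord0) * (y ord0 + iota (a ord0 ord0)^-1
                          * \sum_j iota (b j) * y (lift ord0 j)) ^+ 2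
    + \sum_j \sum_l iota (a (lift ord0 j) (lift ord0 l) - b j * b l / a ord0 ord0)
                  * (y (lift ord0 j) * y (lift ord0 l)).
Proof.
move=> a0; set c := a ord0 ord0 in a0 *; set y0 := y ord0.
set t := \sum_j iota (b j) * _.
have tt : \sum_j \sum_l iota (b j * b l / c) * (y (lift ord0 j) * y (lift ord0 l))
    = iota c^-1 * t ^+ 2.
  rewrite expr2 {1}/t mulr_suml mulr_sumr; apply: eq_bigr => j _.
  rewrite /t !mulr_sumr; apply: eq_bigr => l _; ring.
have -> : \sum_j \sum_l iota (a (lift ord0 j) (lift ord0 l) - b j * b l / c)
                  * (y (lift ord0 j) * y (lift ord0 l))
   = \sum_j \sum_l iota (a (lift ord0 j) (lift ord0 l))
        * (y (lift ord0 j) * y (lift ord0 l)) - iota c^-1 * t ^+ 2.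
  rewrite -tt -sumrB; apply: eq_bigr => j _; rewrite -sumrB.
  by apply: eq_bigr => l _; ring.
have -> : iota c * (y0 + iota c^-1 * t) ^+ 2
    = iota c * y0 ^+ 2 + iota (2 * (c * c^-1)) * (y0 * t)
      + iota (c * c^-1) * (iota c^-1 * t ^+ 2) by ring.
rewrite divff // mulr1 rmorph1 mul1r.
rewrite big_ord_recl big_ord_recl /= -/c -/y0.
under [X in _ + X = _]eq_bigr do rewrite big_ord_recl /= -/y0.
rewrite big_split /=.
have -> : iota 2 * (y0 * t) = \sum_j iota (a ord0 (lift ord0 j)) * (y0 * y (lift ord0 j))
    + \sum_j iota (a (lift ord0 j) ord0) * (y (lift ord0 j) * y0).
  rewrite -big_split /= !mulr_sumr; apply: eq_bigr => j _.
  have -> : a ord0 (lift ord0 j) = 2 * b j - a (lift ord0 j) ord0 by rewrite /b; field.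
  by ring.
by ring.
Qed.

(** Induction on the size: completing the square in the first variable leaves
    the Schur complement, which is again positive definite. *)
Lemma posdef_sum_of_squares (S : comNzRingType) (iota : {rmorphism R -> S}) n
    (a : 'I_n -> 'I_n -> R) :
  (forall v : 'I_n -> R, (exists i, v i != 0) ->
     0 < \sum_j \sum_l a j l * (v j * v l)) ->
  exists L : 'I_n -> 'I_n -> R, forall y : 'I_n -> S,
    \sum_j \sum_l iota (a j l) * (y j * y l) =
    \sum_i (\sum_j iota (L i j) * y j) ^+ 2.
Proof.
elim: n a => [|n IH] a pos; first by exists (fun _ _ => 0) => y; rewrite !big_ord0.
pose ext (T : Type) (t0 : T) (t : 'I_n -> T) (i : 'I_n.+1) :=
  if unlift ord0 i is Some j then t j else t0.
have ext0 T (t0 : T) t : ext T t0 t ord0 = t0 by rewrite /ext unlift_none.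
have extS T (t0 : T) t j : ext T t0 t (lift ord0 j) = t j by rewrite /ext liftK.
set c := a ord0 ord0.
have c0 : 0 < c.
  have := pos (ext R 1 (fun=> 0)) (ex_intro _ ord0 _); rewrite ext0 => /(_ (oner_neq0 _)).
  rewrite big_ord_recl [X in _ + X]big1 => [|j _]; last first.
    by rewrite big1 // => l _; rewrite extS mul0r mulr0.
  rewrite big_ord_recl [X in _ + X + _]big1 => [|l _]; last by rewrite extS !mulr0.
  by rewrite !addr0 !ext0 !mulr1.
have cn0 : c != 0 by rewrite gt_eqF.
pose b j := (a ord0 (lift ord0 j) + a (lift ord0 j) ord0) / 2.
have [v [i vi]|L HL] := IH (fun j l => a (lift ord0 j) (lift ord0 l) - b j * b l / c).
  (* This first coordinate makes the completed square vanish. *)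
  pose w := ext R (- (c^-1 * \sum_j b j * v j)) v.
  have := pos w; rewrite (complete_square idfun w cn0) /= -/c.
  have -> : \sum_j b j * w (lift ord0 j) = \sum_j b j * v j.
    by apply: eq_bigr => j _; rewrite /w extS.
  have -> : w ord0 = - (c^-1 * \sum_j b j * v j) by rewrite /w ext0.
  rewrite addNr expr0n mulr0 add0r.
  under eq_bigr do under eq_bigr do rewrite /w !extS.
  by apply; exists (lift ord0 i); rewrite /w extS.
pose q := Num.sqrt c.
exists (ext _ (ext R q (fun j => q * (b j / c))) (fun i => ext R 0 (L i))) => y.
rewrite complete_square // HL big_ord_recl; congr (_ + _).
  rewrite big_ord_recl ext0 ext0.
  under [X in _ = (_ + X) ^+ 2]eq_bigr do rewrite extS.
  rewrite -/c -[X in iota X * _](sqr_sqrtr (ltW c0)) -/q rmorphXn -exprMn mulrDr.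
  congr ((_ + _) ^+ 2); rewrite mulrA mulr_sumr; apply: eq_bigr => j _.
  by rewrite /b /c; ring.
apply: eq_bigr => i _; rewrite big_ord_recl extS ext0 rmorph0 mul0r add0r.
by congr (_ ^+ 2); apply: eq_bigr => j _; rewrite extS.
Qed.

End PositiveDefiniteForms.

(** * Truncated quadratic modules *)

Section TruncatedModules.
Variables (R : realType) (n m : nat) (g : 'I_m -> {mpoly R[n]}).
Implicit Types (p q f : {mpoly R[n]}) (d k : nat).

Lemma deg_leW d d' p : (d <= d')%N -> deg_le d p -> deg_le d' p.
Proof. by move=> dd' /leq_trans; apply; rewrite ltnS. Qed.

Lemma deg_leM d d' p q : deg_le d p -> deg_le d' q -> deg_le (d + d') (p * q).
Proof.
rewrite /deg_le => hp hq; have [->|p0] := eqVneq p 0; first by rewrite mul0r msize0.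
have [->|q0] := eqVneq q 0; first by rewrite mulr0 msize0.
by rewrite msizeM // -addnS -[leqRHS]/(d.+1 + d'.+1).-1 -!subn1 leq_sub2r // leq_add.
Qed.

Lemma trunc_qmodule_le d d' f : (d <= d')%N ->
  trunc_qmodule d g f -> trunc_qmodule d' g f.
Proof.
move=> dd' [s [sd ->]]; exists s; split => // i p ps.
exact: deg_leW dd' (sd i p ps).
Qed.

Lemma trunc_qmoduleD d f f' :
  trunc_qmodule d g f -> trunc_qmodule d g f' -> trunc_qmodule d g (f + f').
Proof.
move=> [s [sd ->]] [s' [s'd ->]]; exists (fun i => s i ++ s' i); split.
  by move=> i p; rewrite mem_cat => /orP [/sd|/s'd].
by rewrite -big_split /=; apply: eq_bigr => i _; rewrite big_cat.
Qed.

Lemma trunc_qmodule_sqrM d k q f : deg_le k q ->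
  trunc_qmodule d g f -> trunc_qmodule (k + k + d) g (q ^+ 2 * f).
Proof.
move=> qk [s [sd ->]]; exists (fun i => [seq q * p | p <- s i]); split.
  move=> i _ /mapP [p ps ->]; rewrite exprMn -mulrA; apply: deg_leM; last exact: sd.
  by rewrite expr2; apply: deg_leM.
rewrite mulr_sumr; apply: eq_bigr => i _; rewrite big_map mulr_sumr.
by apply: eq_bigr => p _; rewrite exprMn mulrA.
Qed.

Lemma trunc_qmodule1 : trunc_qmodule 0 g 1.
Proof.
exists (fun i => if i == ord0 then [:: 1] else [::]); split.
  move=> i p; case: eqVneq => // -> /[!inE] /eqP ->.
  by rewrite /with_one unlift_none expr1n mulr1 /deg_le msize1.
rewrite (bigD1 ord0) //= big_seq1 /with_one unlift_none expr1n mulr1.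
by rewrite big1 ?addr0 // => i /negPf ->; rewrite big_nil.
Qed.

Lemma trunc_qmodule_sqr k q : deg_le k q -> trunc_qmodule (k + k) g (q ^+ 2).
Proof.
by move=> qk; have := trunc_qmodule_sqrM qk trunc_qmodule1; rewrite mulr1 addn0.
Qed.

Lemma trunc_qmoduleC c : 0 <= c -> trunc_qmodule 0 g c%:MP.
Proof.
move=> c0; rewrite -(sqr_sqrtr c0) rmorphXn; apply: (@trunc_qmodule_sqr 0).
by rewrite /deg_le msizeC; case: eqP.
Qed.

Lemma trunc_qmodule_sum (I : Type) (l : seq I) (P : pred I) (F : I -> {mpoly R[n]}) d :
  (forall i, P i -> trunc_qmodule d g (F i)) ->
  trunc_qmodule d g (\sum_(i <- l | P i) F i).
Proof.
move=> FT; apply: big_ind => //; last by move=> p q; apply: trunc_qmoduleD.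
exact: trunc_qmodule_le (leq0n d) (trunc_qmoduleC (lexx 0)).
Qed.

Lemma trunc_qmodule_ge0 d f x : trunc_qmodule d g f -> semialg g x -> 0 <= peval f x.
Proof.
move=> [s [_ ->]] gx; rewrite /peval raddf_sum; apply: sumr_ge0 => i _.
rewrite raddf_sum; apply: sumr_ge0 => p _ /=; rewrite mevalM rmorphXn mulr_ge0 ?sqr_ge0 //.
by rewrite /with_one; case: unliftP => [j _|_]; [apply: gx|rewrite meval1].
Qed.

End TruncatedModules.

(** * Bounded families of polynomials *)

Section BoundedElements.
Variables (R : realType) (A : comNzRingType) (iota : {rmorphism R -> A}).
Variable M : set A.
Hypothesis qM : quadratic_module M.

Definition bounded_element a : Prop := exists c, M (iota c - a) /\ M (iota c + a).

Lemma bounded_elementD a b :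
  bounded_element a -> bounded_element b -> bounded_element (a + b).
Proof.
move=> [c [c1 c2]] [d [d1 d2]]; exists (c + d); split.
  by have := qmD qM c1 d1; congr M; ring.
by have := qmD qM c2 d2; congr M; ring.
Qed.

Lemma bounded_elementN a : bounded_element a -> bounded_element (- a).
Proof. by move=> [c [c1 c2]]; exists c; rewrite opprK. Qed.

(** [2 c (c ^+ 2 - a ^+ 2) = (c + a) ^+ 2 (c - a) + (c - a) ^+ 2 (c + a)]. *)
Lemma bounded_sqr a : bounded_element a -> exists c, M (iota c - a ^+ 2).
Proof.
move=> [c0 [m1 m2]]; pose c := `|c0| + 1.
have c_gt0 : 0 < c by rewrite ltr_wpDl.
have Mc : M (iota (c - c0)) by apply: qmC => //; have := ler_norm c0; rewrite /c; lra.
have {}m1 : M (iota c - a) by have := qmD qM Mc m1; congr M; ring.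
have {}m2 : M (iota c + a) by have := qmD qM Mc m2; congr M; ring.
exists (c ^+ 2); apply: (@qmZ_inv _ _ iota _ qM (2 * c)); first by lra.
have := qmD qM (qmX qM (iota c + a) m1) (qmX qM (iota c - a) m2).
by congr M; ring.
Qed.

(** Polarization reduces products to squares. *)
Lemma bounded_elementM a b :
  bounded_element a -> bounded_element b -> bounded_element (a * b).
Proof.
move=> ba bb.
have [c Mc] := bounded_sqr (bounded_elementD ba bb).
have [d Md] := bounded_sqr (bounded_elementD ba (bounded_elementN bb)).
exists ((c + d) / 4).
split; apply: (@qmZ_inv _ _ iota _ qM 4); try by lra.
  have := qmD qM (qmD qM Mc (qm_sqr qM (a - b))) (qmD qM Md (qm_sqr qM (a - b))).
  have -> : iota 4 * (iota ((c + d) / 4) - a * b) =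
    iota (4 * ((c + d) / 4)) - 4 * a * b by ring.
  by rewrite (_ : 4 * _ = c + d); [congr M; ring|lra].
have := qmD qM (qmD qM Mc (qm_sqr qM (a + b))) (qmD qM Md (qm_sqr qM (a + b))).
have -> : iota 4 * (iota ((c + d) / 4) + a * b) =
  iota (4 * ((c + d) / 4)) + 4 * a * b by ring.
by rewrite (_ : 4 * _ = c + d); [congr M; ring|lra].
Qed.

End BoundedElements.

Section BoundedFamilies.
Variables (T : pointedType) (R : realType).

Definition bounded_family : {pred T -> R} :=
  fun c => `[< exists K, forall t, `|c t| <= K >].

Lemma bounded_familyP c :
  reflect (exists K, forall t, `|c t| <= K) (c \in bounded_family).
Proof. exact: asboolP. Qed.

Lemma bounded_family_subring : subring_closed bounded_family.
Proof.
split.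
- by apply/bounded_familyP; exists 1 => t; rewrite normr1.
- move=> c c' /bounded_familyP [K cK] /bounded_familyP [K' cK'].
  apply/bounded_familyP; exists (K + K') => t.
  by rewrite (le_trans (ler_normB _ _)) // lerD.
- move=> c c' /bounded_familyP [K cK] /bounded_familyP [K' cK'].
  by apply/bounded_familyP; exists (K * K') => t; rewrite normrM ler_pM.
Qed.

HB.instance Definition _ :=
  GRing.isSubringClosed.Build (T -> R) bounded_family bounded_family_subring.

Record bfam := BFam { bfam_val :> T -> R; bfamP : bfam_val \in bounded_family }.

HB.instance Definition _ := [isSub for bfam_val].
HB.instance Definition _ := [Choice of bfam by <:].
HB.instance Definition _ := [SubChoice_isSubComNzRing of bfam by <:].

Lemma bfam_ext (b c : bfam) : (forall t, b t = c t) -> b = c.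
Proof. by move=> bc; apply: val_inj; apply/funext. Qed.

Lemma bfam_bound (b : bfam) : exists K, forall t, `|b t| <= K.
Proof. exact/bounded_familyP/bfamP. Qed.

Definition bfam_at (t : T) (b : bfam) : R := b t.

Lemma bfam_at_zmod t : zmod_morphism (bfam_at t).
Proof. by []. Qed.

Lemma bfam_at_monoid t : monoid_morphism (bfam_at t).
Proof. by []. Qed.

HB.instance Definition _ t :=
  GRing.isZmodMorphism.Build bfam R (bfam_at t) (bfam_at_zmod t).
HB.instance Definition _ t :=
  GRing.isMonoidMorphism.Build bfam R (bfam_at t) (bfam_at_monoid t).

Lemma cst_bounded (c : R) : (fun=> c) \in bounded_family.
Proof. by apply/bounded_familyP; exists `|c|. Qed.

Definition bcst (c : R) : bfam := BFam (cst_bounded c).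

Lemma bcst_zmod : zmod_morphism bcst.
Proof. by move=> b c; apply: bfam_ext. Qed.

Lemma bcst_monoid : monoid_morphism bcst.
Proof. by split=> [|b c]; apply: bfam_ext. Qed.

HB.instance Definition _ := GRing.isZmodMorphism.Build R bfam bcst bcst_zmod.
HB.instance Definition _ := GRing.isMonoidMorphism.Build R bfam bcst bcst_monoid.

Section Polynomials.
Variable n : nat.
Local Notation A := {mpoly bfam[n]}.

Definition fconst : {rmorphism R -> A} := @mpolyC n bfam \o bcst.
Definition fiber (t : T) : {rmorphism A -> {mpoly R[n]}} := map_mpoly (bfam_at t).
Definition flift : {rmorphism {mpoly R[n]} -> A} := map_mpoly bcst.

Lemma fiberC t c : fiber t c%:MP = (c t)%:MP.
Proof. exact: map_mpolyC. Qed.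

Lemma fiberX t i : fiber t 'X_i = 'X_i.
Proof. exact: map_mpolyX. Qed.

Lemma fiber_const t c : fiber t (fconst c) = c%:MP.
Proof. exact: fiberC. Qed.

Lemma fiber_lift t p : fiber t (flift p) = p.
Proof.
elim/mpoly_ring_ind: p => [c|i|p q hp hq|p q hp hq].
- by rewrite /flift /= map_mpolyC fiberC.
- by rewrite /flift /= map_mpolyX fiberX.
- by rewrite !rmorphD hp hq.
- by rewrite !rmorphM hp hq.
Qed.

Lemma fiber_eval t (z : 'I_n -> bfam) (p : A) :
  p.@[z] t = (fiber t p).@[fun i => z i t].
Proof.
elim/mpoly_ring_ind: p => [c|i|p q hp hq|p q hp hq].
- by rewrite fiberC !mevalC.
- by rewrite fiberX !mevalXU.
- by rewrite mevalD (rmorphD (fiber t)) mevalD -hp -hq.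
- by rewrite mevalM (rmorphM (fiber t)) mevalM -hp -hq.
Qed.

Lemma fiber_msize t (p : A) : (msize (fiber t p) <= msize p)%N.
Proof.
rewrite msizeE; apply/bigmax_leqP_seq => m mp _; apply: msize_mdeg_lt.
rewrite mcoeff_msupp mcoeff_map_mpoly in mp.
by rewrite mcoeff_msupp; apply: contra_neq mp => ->.
Qed.

Lemma bounded_family_of_mpoly (F : T -> {mpoly R[n]}) (N : nat) (K : R) :
  (forall t, deg_le N (F t)) -> (forall t m, `|(F t)@_m| <= K) ->
  exists f : A, forall t, fiber t f = F t.
Proof.
move=> Fdeg FK.
have cb m : (fun t => (F t)@_m) \in bounded_family by apply/bounded_familyP; exists K.
exists (\sum_(m : 'X_{1..n < N.+1}) (BFam (cb m))%:MP * 'X_[m]) => t.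
rewrite rmorph_sum /= [RHS](mpolywE (Fdeg t)); apply: eq_bigr => m _.
by rewrite rmorphM /= map_mpolyC map_mpolyX mul_mpolyC.
Qed.

Variables (m : nat) (g : 'I_m -> {mpoly R[n]}).

(** Membership of a family is a degree bound common to all the parameters, so that
    uniformity becomes a statement about one element of one ring. *)
Definition uniform_qmodule : set A :=
  [set p | exists d, forall t, trunc_qmodule d g (fiber t p)].

Lemma uniform_quadratic_module : quadratic_module uniform_qmodule.
Proof.
split.
- by exists 0%N => t; rewrite rmorph1; apply: trunc_qmodule1.
- move=> a b [d ad] [d' bd]; exists (maxn d d') => t; rewrite rmorphD.
  apply: trunc_qmoduleD; first exact: trunc_qmodule_le (leq_maxl _ _) (ad t).
  exact: trunc_qmodule_le (leq_maxr _ _) (bd t).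
- move=> a b [d bd]; exists (msize a + msize a + d)%N => t.
  rewrite rmorphM rmorphXn; apply: trunc_qmodule_sqrM => //.
  by rewrite /deg_le ltnW // ltnS fiber_msize.
Qed.

Lemma uniform_qmodule_nonneg (c : bfam) :
  (forall t, 0 <= c t) -> uniform_qmodule c%:MP.
Proof. by move=> c0; exists 0%N => t; rewrite fiberC; apply: trunc_qmoduleC. Qed.

(** Bounded elements form a ring, so that the Archimedean property need only be
    checked on the coefficients, which are bounded, and on the variables. *)
Lemma uniform_order_unit : archimedean g -> order_unit fconst uniform_qmodule.
Proof.
move=> hg a; suff [c []] : bounded_element fconst uniform_qmodule a by exists c.
elim/mpoly_ring_ind: a => [c|i|p q|p q].
- have [K cK] := bfam_bound c; exists K; split.
    have -> : fconst K - c%:MP = (bcst K - c)%:MP by rewrite mpolyCB.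
    apply: uniform_qmodule_nonneg => t.
    by rewrite subr_ge0 (le_trans (ler_norm _) (cK t)).
  have -> : fconst K + c%:MP = (bcst K + c)%:MP by rewrite mpolyCD.
  apply: uniform_qmodule_nonneg => t; have := cK t.
  by rewrite ler_norml => /andP [+ _]; rewrite -subr_ge0 opprK addrC.
- have [N [_ [d1 _ h1] [d2 _ h2]]] := hg 'X_i.
  exists N%:R; split.
    by exists d2 => t; rewrite rmorphB fiber_const fiberX rmorph_nat.
  by exists d1 => t; rewrite rmorphD fiber_const fiberX rmorph_nat.
- by apply: bounded_elementD; apply: uniform_quadratic_module.
- by apply: bounded_elementM; apply: uniform_quadratic_module.
Qed.

Section Character.
Variable phi : {rmorphism A -> R}.
Hypothesis phi_const : forall c, phi (fconst c) = c.
Hypothesis phi_ge0 : forall a, uniform_qmodule a -> 0 <= phi a.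

Definition character_point : 'rV[R]_n := \row_i phi 'X_i.

(** A character sees a family only through the values of its members at one fixed
    point, since it kills [p - p(z)], a combination of the ['X_i - z_i]. *)
Lemma character_eval (p : A) :
  phi p = phi (p.@[fun i => bcst (character_point ord0 i)])%:MP.
Proof.
have [r] := mpoly_translate (fun i => bcst (character_point ord0 i)) p.
set c := p.@[_] => ->; rewrite rmorphD [X in _ + X]rmorph_sum big1 ?addr0 // => i _.
by rewrite rmorphM rmorphB /= -[_%:MP]/(fconst _) phi_const mxE subrr mulr0.
Qed.

Lemma character_point_ge0 (p : A) :
  (forall t, 0 <= peval (fiber t p) character_point) -> 0 <= phi p.
Proof.
move=> p0; rewrite character_eval; apply/phi_ge0/uniform_qmodule_nonneg => t.
by rewrite fiber_eval; apply: p0.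
Qed.

Lemma character_point_semialg : semialg g character_point.
Proof.
move=> i; have : uniform_qmodule (flift (g i)).
  exists (msize (g i)) => t; rewrite fiber_lift.
  exists (fun j => if j == lift ord0 i then [:: 1] else [::]); split.
    move=> j p; case: eqVneq => // -> /[!inE] /eqP ->.
    by rewrite /with_one liftK expr1n mul1r /deg_le.
  rewrite (bigD1 (lift ord0 i)) //= eqxx big_seq1 /with_one liftK expr1n mul1r.
  by rewrite big1 ?addr0 // => j /negPf ->; rewrite big_nil.
move=> /phi_ge0; rewrite character_eval.
rewrite (_ : _.@[_] = bcst (peval (g i) character_point)) ?phi_const //.
by apply: bfam_ext => t; rewrite fiber_eval fiber_lift.
Qed.

End Character.
End Polynomials.
End BoundedFamilies.

(** * The uniform representation *)

Section SquaredDistance.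
Variables (R : realType) (n : nat).
Implicit Types x y : 'rV[R]_n.

Definition sqdist x y : R := \sum_i (y ord0 i - x ord0 i) ^+ 2.

Lemma sqdist_ge0 x y : 0 <= sqdist x y.
Proof. by apply: sumr_ge0 => i _; apply: sqr_ge0. Qed.

Lemma eballE x (e : R) y : 0 < e -> eball x e y <-> sqdist x y < e ^+ 2.
Proof.
move=> e0; rewrite /eball /enorm /=.
have -> : \sum_(i < n) (x - y) ord0 i ^+ 2 = sqdist x y.
  by apply: eq_bigr => i _; rewrite !mxE; ring.
by rewrite -{1}(gtr0_norm e0) -sqrtr_sqr ltr_sqrt // exprn_gt0.
Qed.

Lemma upoly_eval x y : peval (upoly x) y = sqdist x y.
Proof.
rewrite /peval /upoly raddf_sum; apply: eq_bigr => i _.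
by rewrite /= rmorphXn /= mevalB mevalXU mevalC.
Qed.

Lemma upoly_prod_eval k (z : 'I_k -> 'rV[R]_n) y :
  peval (\prod_(i < k) upoly (z i)) y = \prod_(i < k) sqdist (z i) y.
Proof.
by rewrite /peval rmorph_prod; apply: eq_bigr => i _; apply: upoly_eval.
Qed.

Lemma sqdist_parallelogram x y z : sqdist x z <= 2 * sqdist x y + 2 * sqdist y z.
Proof.
rewrite /sqdist !mulr_sumr -big_split /=; apply: ler_sum => i _.
rewrite -subr_ge0.
by rewrite (_ : _ - _ = (2 * y ord0 i - x ord0 i - z ord0 i) ^+ 2) ?sqr_ge0 //; ring.
Qed.

End SquaredDistance.

Section UniformRepresentation.
Variables (T : pointedType) (R : realType) (n m k : nat).
Variables (g : 'I_m -> {mpoly R[n]}) (e : R).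
Variables (F : T -> {mpoly R[n]}) (xs : T -> 'I_k -> 'rV[R]_n).
Hypothesis hg : archimedean g.
Hypothesis e0 : 0 < e.
Hypothesis Fxs : forall t i, peval (F t) (xs t i) = 0.
Hypothesis xs_sep : forall t i j, i != j -> e ^+ 2 <= sqdist (xs t i) (xs t j).
Hypothesis ball_sub : forall t i, eball (xs t i) e `<=` semialg g.
Hypothesis F_ge : forall t x, semialg g x ->
  e * peval (\prod_(i < k) upoly (xs t i)) x <= peval (F t) x.

Local Notation A := {mpoly (bfam T R)[n]}.
Local Notation fib := (@fiber T R n).
Local Notation iota := (@fconst T R n).
Local Notation M := (@uniform_qmodule T R n m g).

Let qM : quadratic_module M := uniform_quadratic_module T g.
Let oM : order_unit iota M := uniform_order_unit hg.

Lemma xs_semialg t i : semialg g (xs t i).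
Proof.
apply: (ball_sub (t := t) (i := i)); apply/eballE => //.
by rewrite /sqdist big1 ?exprn_gt0 // => j _; rewrite subrr expr0n.
Qed.

Lemma xs_bounded i l : (fun t => xs t i ord0 l) \in @bounded_family T R.
Proof.
have [K [_ [d _ hd] [d' _ hd']]] := hg 'X_l.
apply/bounded_familyP; exists K%:R => t.
have := trunc_qmodule_ge0 hd (xs_semialg t i).
have := trunc_qmodule_ge0 hd' (xs_semialg t i).
rewrite /peval mevalB mevalD mevalXU -mpolyC_nat mevalC => h1 h2.
by rewrite ler_norml; apply/andP; split; lra.
Qed.

Let X i l : bfam T R := BFam (xs_bounded i l).
Let Z i l : A := 'X_l - (X i l)%:MP.
Let u i : A := \sum_l Z i l ^+ 2.
Let U : A := \prod_(i < k) u i.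

Lemma fiber_Z t i l : fib t (Z i l) = 'X_l - (xs t i ord0 l)%:MP.
Proof. by rewrite rmorphB fiberX fiberC. Qed.

Lemma fiber_u t i : fib t (u i) = upoly (xs t i).
Proof. by rewrite rmorph_sum; apply: eq_bigr => l _; rewrite rmorphXn /= -fiber_Z. Qed.

Lemma u_multiplier i : multiplier M (u i).
Proof. by apply: multiplier_sum => // l _; apply: multiplier_sqr. Qed.

Lemma U_multiplier : multiplier M U.
Proof. by apply: multiplier_prod => // i _; apply: u_multiplier. Qed.

Lemma Z_le_u i l : M (u i - Z i l ^+ 2).
Proof.
rewrite /u (bigD1 l) //= addrAC subrr add0r.
by apply: qm_sum => // j _; apply: qm_sqr.
Qed.

Lemma Z_dominated i l : dominated iota M (u i) (Z i l).
Proof. by exists 1; rewrite rmorph1 mul1r; apply: Z_le_u. Qed.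

(** The coordinates of [x_i - x_j] are differences of elements vanishing at
    [x_j] and at [x_i]; the sum of their squares is at least [e ^+ 2], so that its inverse
    is a bounded family. *)
Lemma zeros_comaximal i j : i != j -> exists y z,
  [/\ dominated iota M (u i) y, dominated iota M (u j) z & y + z = 1].
Proof.
move=> ij.
pose D l := X i l - X j l.
have cge t : e ^+ 2 <= \sum_l D l t ^+ 2.
  by rewrite eq_sym in ij; apply: le_trans (xs_sep t ij) _.
have c_gt0 t : 0 < \sum_l D l t ^+ 2 by apply: lt_le_trans (cge t); rewrite exprn_gt0.
have cb : (fun t => (\sum_l D l t ^+ 2)^-1) \in @bounded_family T R.
  apply/bounded_familyP; exists (e ^+ 2)^-1 => t.
  by rewrite gtr0_norm ?invr_gt0 // lef_pV2 ?posrE ?exprn_gt0.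
exists (\sum_l (- (BFam cb * D l)%:MP) * Z i l), (\sum_l (BFam cb * D l)%:MP * Z j l).
split.
- apply: dominated_sum => // l _; apply: dominatedM => //.
    exact: u_multiplier.
  exact: Z_dominated.
- apply: dominated_sum => // l _; apply: dominatedM => //.
    exact: u_multiplier.
  exact: Z_dominated.
rewrite -big_split /=.
have -> : 1 = (BFam cb * \sum_l D l ^+ 2)%:MP :> A.
  rewrite -mpolyC1; congr (_ %:MP); apply: bfam_ext => t.
  rewrite -[RHS]/(bfam_at t _) rmorphM rmorph_sum.
  exact: (esym (mulVf (lt0r_neq0 (c_gt0 t)))).
rewrite mulr_sumr raddf_sum; apply: eq_bigr => l _.
have DE : (D l)%:MP = Z j l - Z i l by rewrite /D /Z mpolyCB; ring.
by rewrite expr2 mulrA [RHS]mpolyCM DE; ring.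
Qed.

Variable f : A.
Hypothesis fF : forall t, fib t f = F t.

Let kappa i := e * \prod_(j < k | j != i) (e ^+ 2 / 4).

Lemma kappa_gt0 i : 0 < kappa i.
Proof.
rewrite mulr_gt0 // prodr_gt0 // => j _.
by rewrite divr_gt0 // exprn_gt0.
Qed.

(** Within [e / 2] of a zero all the other zeros are at distance at least [e / 2];
    squared distances only satisfy the triangle inequality up to a factor [2], which
    is enough here. *)
Lemma F_quadratic_lower_bound t i y : sqdist (xs t i) y <= e ^+ 2 / 4 ->
  kappa i * sqdist (xs t i) y <= peval (F t) y.
Proof.
move=> xy; have e2 : 0 < e ^+ 2 by rewrite exprn_gt0.
have Sy : semialg g y.
  by apply: (ball_sub (t := t) (i := i)); apply/eballE => //; lra.
apply: le_trans (F_ge t Sy); rewrite /kappa -mulrA ler_pM2l //.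
rewrite upoly_prod_eval [leRHS](bigD1 i) //= mulrC.
rewrite ler_wpM2l ?sqdist_ge0 //; apply: ler_prod => j ji.
apply/andP; split; first by lra.
have := sqdist_parallelogram (xs t i) y (xs t j).
rewrite eq_sym in ji; have := xs_sep t ji.
have -> : sqdist y (xs t j) = sqdist (xs t j) y.
  by apply: eq_bigr => l _; ring.
lra.
Qed.

(** Both the constant and the linear terms of the Taylor expansion vanish, since each
    member has a zero minimum at its [i]-th zero. *)
Lemma local_expansion i : exists (a : 'I_n -> 'I_n -> bfam T R)
    (w : 'I_n -> A),
  [/\ f = \sum_j \sum_l (a j l)%:MP * (Z i j * Z i l) + \sum_j w j * Z i j,
      forall j, dominated iota M (u i * u i) (w j) &
      forall t v, kappa i * \sum_j v j ^+ 2 <= \sum_j \sum_l a j l t * (v j * v l)].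
Proof.
have [d [a [b fE]]] := mpoly_taylor2 (X i) f.
have f0 : f.@[X i] = 0.
  by apply: bfam_ext => t; rewrite fiber_eval fF; apply: Fxs.
have loc t : (forall j, d j t = 0) /\
    (forall v, kappa i * \sum_j v j ^+ 2 <= \sum_j \sum_l a j l t * (v j * v l)).
  apply: (@second_order_minimum R n (xs t i ord0) (F t) _ _
    (fun j l m => fib t (b j l m)) _ (e ^+ 2 / 4)).
  - rewrite -fF {1}fE f0 mpolyC0 add0r !rmorphD !rmorph_sum.
    congr (_ + _ + _); apply: eq_bigr => j _.
    + by rewrite rmorphM fiber_Z fiberC.
    + rewrite rmorph_sum; apply: eq_bigr => l _.
      by rewrite !rmorphM !fiber_Z fiberC.
    + rewrite rmorphM fiber_Z rmorph_sum; congr (_ * _); apply: eq_bigr => l _.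
      rewrite rmorph_sum; apply: eq_bigr => p _.
      by rewrite !rmorphM !fiber_Z.
  - by rewrite divr_gt0 // exprn_gt0.
  - move=> y; have := @F_quadratic_lower_bound t i (\row_l y l).
    have -> : sqdist (xs t i) (\row_l y l) = \sum_l (y l - xs t i ord0 l) ^+ 2.
      by apply: eq_bigr => l _; rewrite mxE.
    rewrite /peval (@meval_eq _ _ _ y) // => l; by rewrite mxE.
exists a, (fun j => \sum_l \sum_p b j l p * (Z i l * Z i p)); split.
- rewrite {1}fE f0 mpolyC0 add0r big1 ?add0r // => j _.
  rewrite (_ : d j = 0) ?mpolyC0 ?mul0r //; apply: bfam_ext => t.
  exact: (loc t).1.
- have muu : multiplier M (u i * u i) by apply: multiplierM; apply: u_multiplier.
  move=> j; apply: dominated_sum => // l _; apply: dominated_sum => // p _.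
  apply: dominatedM => //; apply: dominated_mul => //; try exact: u_multiplier.
    exact: Z_dominated.
  exact: Z_dominated.
- by move=> t; apply: (loc t).2.
Qed.

Lemma f_bounded_by_u i : bounded_by iota M (u i) f.
Proof.
have [a [w [-> dw _]]] := local_expansion i.
have mu := u_multiplier i; have dZ := Z_dominated i.
have -> : \sum_j \sum_l (a j l)%:MP * (Z i j * Z i l) + \sum_j w j * Z i j =
    \sum_j (\sum_l (a j l)%:MP * Z i l + w j) * Z i j.
  rewrite -big_split; apply: eq_bigr => j _; rewrite mulrDl mulr_suml; congr (_ + _).
  by apply: eq_bigr => l _; ring.
apply: bounded_by_sum => // j _; apply: dominated_bounded => //; apply: dominatedD => //.
  by apply: dominated_sum => // l _; apply: dominatedM.
have [K MK] := dw j; have [c Mc] := oM (iota K * u i).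
exists c; have := qmD qM (mu _ Mc) MK; congr M; ring.
Qed.

Lemma f_bounded_by_U : bounded_by iota M U f.
Proof.
apply: bounded_by_prod => //; first exact: index_enum_uniq.
- exact: u_multiplier.
- exact: zeros_comaximal.
- exact: f_bounded_by_u.
Qed.

(** [r Z^2 + w Z] is a square up to [w ^+ 2 / (4 r)], and [w] is of order two at the
    zero, so that [w ^+ 2] is bounded by a multiple of [u i ^+ 2]. *)
Lemma absorb_cubic i (w : 'I_n -> A) (r : R) : 0 < r ->
  (forall j, dominated iota M (u i * u i) (w j)) ->
  exists c, M (iota r * u i + \sum_j w j * Z i j + iota c * (u i * u i)).
Proof.
move=> r0 dw.
have term j : exists c, M (iota r * Z i j ^+ 2 + w j * Z i j + iota c * (u i * u i)).
  have [c Mc] := dw j; exists (c / (4 * r)).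
  have r4 : 0 < 4 * r by lra.
  apply: (@qmZ_inv _ _ iota _ qM (4 * r)) => //.
  have := qmD qM (qm_sqr qM (iota (2 * r) * Z i j + w j)) Mc; congr M.
  have -> : iota (4 * r) *
      (iota r * Z i j ^+ 2 + w j * Z i j + iota (c / (4 * r)) * (u i * u i)) =
    iota (4 * r) * (iota r * Z i j ^+ 2 + w j * Z i j)
      + iota (4 * r * (c / (4 * r))) * (u i * u i) by ring.
  rewrite [4 * r * _]mulrC divfK ?gt_eqF //; ring.
have /choice [c Mc] := term; exists (\sum_j c j).
have := @qm_sum _ _ qM _ (index_enum _) xpredT _ (fun j _ => Mc j).
by rewrite (rmorph_sum iota) !big_split /= -mulr_sumr -mulr_suml.
Qed.

(** For each parameter the left-hand side is a positive definite form in the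
    [Z i j], hence a sum of squares of polynomials of degree at most [1]. *)
Lemma hessian_part i (a : 'I_n -> 'I_n -> bfam T R) (r : R) :
  0 < r ->
  (forall t v, 2 * r * \sum_j v j ^+ 2 <= \sum_j \sum_l a j l t * (v j * v l)) ->
  M (\sum_j \sum_l (a j l)%:MP * (Z i j * Z i l) - iota r * u i).
Proof.
move=> r0 apos; exists 2%N => t.
pose c j l := a j l t - r *+ (j == l).
have cE (S : comNzRingType) (h : {rmorphism R -> S}) (y : 'I_n -> S) :
    \sum_j \sum_l h (c j l) * (y j * y l) =
    \sum_j \sum_l h (a j l t) * (y j * y l) - h r * \sum_j y j ^+ 2.
  rewrite mulr_sumr -sumrB; apply: eq_bigr => j _.
  under eq_bigr do rewrite rmorphB mulrBl.
  rewrite sumrB; congr (_ - _); rewrite (bigD1 j) //= eqxx mulr1n big1 ?addr0 ?expr2 //.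
  by move=> l /negPf; rewrite eq_sym => ->; rewrite mulr0n rmorph0 mul0r.
have [v [p vp]|L HL] := @posdef_sum_of_squares R {mpoly R[n]} (@mpolyC n R) n c.
  rewrite (cE R idfun) /= subr_gt0.
  apply: lt_le_trans (apos t v); rewrite ltr_pM2r; first by lra.
  rewrite (bigD1 p) //= ltr_wpDr ?sumr_ge0 // => [l _|]; first exact: sqr_ge0.
  by rewrite exprn_even_gt0 ?vp ?orbT.
have -> : fib t (\sum_j \sum_l (a j l)%:MP * (Z i j * Z i l) - iota r * u i)
   = \sum_j (\sum_l (L j l)%:MP * ('X_l - (xs t i ord0 l)%:MP)) ^+ 2.
  rewrite -HL (cE _ (@mpolyC n R)) rmorphB rmorphM fiber_const !rmorph_sum.
  congr (_ - _ * _); apply: eq_bigr => j _; last by rewrite rmorphXn -fiber_Z.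
  rewrite rmorph_sum; apply: eq_bigr => l _.
  by rewrite !rmorphM !fiber_Z fiberC.
apply: trunc_qmodule_sum => j _; apply: (@trunc_qmodule_sqr _ _ _ _ 1).
apply: (big_ind (deg_le 1)) => [|p q hp hq|l _].
- by rewrite /deg_le msize0.
- by rewrite /deg_le (leq_trans (msizeD_le _ _)) // geq_max hp hq.
- apply: (@deg_leM _ _ 0 1); first by rewrite /deg_le msizeC; case: eqP.
  rewrite /deg_le (leq_trans (msizeD_le _ _)) // geq_max msizeN msizeC.
  by rewrite msizeX mdeg1; case: eqP.
Qed.

Lemma local_certificate i : exists r c,
  0 < r /\ M (f - iota r * u i + iota c * (u i * u i)).
Proof.
have [a [w [fE dw apos]]] := local_expansion i.
have k0 := kappa_gt0 i; pose r := kappa i / 4.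
have r0 : 0 < r by rewrite divr_gt0.
have [c Mc] := absorb_cubic r0 dw.
have Ma : M (\sum_j \sum_l (a j l)%:MP * (Z i j * Z i l) - iota (2 * r) * u i).
  apply: hessian_part; first by lra.
  by move=> t v; rewrite (_ : 2 * (2 * r) = kappa i) //; rewrite /r; lra.
exists r, c; split => //.
by have := qmD qM Ma Mc; rewrite fE; congr M; ring.
Qed.

Lemma f_in_uniform_qmodule : M f.
Proof.
apply: (local_global qM oM U_multiplier f_bounded_by_U) => phi phi_ge0 phi_const.
have [[i ui]|no_zero] := pselect (exists i, phi (u i) = 0).
  (* By comaximality, [phi] vanishing on [u i] cannot vanish on any other [u j]. *)
  pose W := \prod_(j < k | j != i) u j.
  have UW : U = u i * W by rewrite /U (bigD1 i).
  have mW : multiplier M W by apply: multiplier_prod => // j _; apply: u_multiplier.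
  have W0 : 0 < phi W.
    rewrite rmorph_prod prodr_gt0 // => j ji; rewrite lt_neqAle.
    rewrite phi_ge0 ?andbT; last by apply: multiplier_in => //; apply: u_multiplier.
    rewrite eq_sym; apply/eqP => uj.
    have [y [z [dy dz yz]]] := zeros_comaximal ji.
    have := rmorph1 phi; rewrite -yz rmorphD.
    rewrite (dominated_zero phi_ge0 uj dy) (dominated_zero phi_ge0 ui dz) addr0.
    by move/eqP; rewrite eq_sym oner_eq0.
  have [r [c [r0 Mrc]]] := local_certificate i.
  exists (W ^+ 2), (- (iota r - iota c * u i) * W); split.
  - exact: multiplier_sqr.
  - by have := qmX qM W Mrc; rewrite UW; congr M; ring.
  - rewrite rmorphM rmorphN rmorphB rmorphM ui mulr0 subr0 phi_const mulNr.
    by rewrite oppr_lt0 mulr_gt0.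
have U0 : 0 < phi U.
  rewrite rmorph_prod prodr_gt0 // => i _; rewrite lt_neqAle.
  rewrite phi_ge0 ?andbT; last by apply: multiplier_in => //; apply: u_multiplier.
  by rewrite eq_sym; apply/eqP => ui; apply: no_zero; exists i.
have feU : 0 <= phi (f - iota e * U).
  apply: (character_point_ge0 phi_const phi_ge0) => t.
  have := F_ge t (character_point_semialg phi_const phi_ge0).
  rewrite rmorphB rmorphM fF fiber_const rmorph_prod.
  under [X in _ - _ * X]eq_bigr do rewrite fiber_u.
  by rewrite /peval mevalB mevalM mevalC subr_ge0.
have f0 : 0 < phi f.
  move: feU; rewrite rmorphB rmorphM phi_const subr_ge0; apply: lt_le_trans.
  exact: mulr_gt0.
exists (U ^+ 2), (- (U * f)); split.
- exact: multiplier_sqr.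
- by rewrite (_ : _ + _ = 0); [apply: qm0|ring].
- by rewrite rmorphN rmorphM oppr_lt0 mulr_gt0.
Qed.

End UniformRepresentation.

(** * Extraction of a common degree *)

Theorem theorem31 (R : realType) (n m : nat) (g : 'I_m -> {mpoly R[n]})
    (hg : archimedean g) (k N : nat) (hN : (0 < N)%N) (e : R) (he : 0 < e) :
  exists d : nat,
    forall f : {mpoly R[n]},
      deg_le N f ->
      (forall a : 'X_{1..n}, - N%:R <= f@_a <= N%:R) ->
    forall xs : 'I_k -> 'rV[R]_n,
      [set x | semialg g x /\ peval f x = 0] = range xs ->
      trivIset setT (fun i => eball (xs i) e) ->
      (forall i, eball (xs i) e `<=` semialg g) ->
      (forall x, semialg g x ->
         e * peval (\prod_(i < k) upoly (xs i)) x <= peval f x) ->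
      trunc_qmodule d g f.
Proof.
apply: contrapT => nod.
pose bad (d : nat) (c : {mpoly R[n]} * ('I_k -> 'rV[R]_n)) :=
  [/\ deg_le N c.1, forall a, `|(c.1)@_a| <= N%:R,
      (forall i, peval c.1 (c.2 i) = 0) /\
      (forall i j, i != j -> e ^+ 2 <= sqdist (c.2 i) (c.2 j)),
      (forall i, eball (c.2 i) e `<=` semialg g) /\
      (forall x, semialg g x ->
         e * peval (\prod_(i < k) upoly (c.2 i)) x <= peval c.1 x) &
      ~ trunc_qmodule d g c.1].
(* If no degree works, a sequence [c] of data refuting each of the degrees is a
   single family to which the uniform representation applies. *)
have /choice [c cbad] : forall d, exists c, bad d c.
  move=> d; apply: contrapT => nobad; apply: nod; exists d.
  move=> f fdeg fcoef xs zeros disj balls lower; apply: contrapT => fd.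
  apply: nobad; exists (f, xs); split => //=.
    by move=> a; rewrite ler_norml.
  split=> [i|i j ij].
    have : range xs (xs i) by exists i.
    by rewrite -zeros => -[].
  rewrite leNgt; apply/negP => close; move/eqP: ij; apply.
  apply: disj => //; exists (xs j); split; first exact/eballE.
  apply/eballE => //; rewrite /sqdist big1 ?exprn_gt0 // => l _.
  by rewrite subrr expr0n.
have [f fF] : exists f, forall d : nat, @fiber nat R n d f = (c d).1.
  by apply: (@bounded_family_of_mpoly _ _ _ _ N N%:R) => d; have [] := cbad d.
have [||||d dF] := @f_in_uniform_qmodule nat R n m k g e
  (fun d => (c d).1) (fun d => (c d).2) hg he _ _ _ _ f fF.
all: try by move=> d; have [? ? [? ?] [? ?] ?] := cbad d.
by have [_ _ _ _] := cbad d; rewrite -fF; apply; apply: dF.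
Qed.
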